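(* Let $A$ be a Boolean algebra. The following conditions are equivalent: (i) $A$ is complete and atomic; (ii) $A$ is order compact; (iii) $A$ is order locally compact.
   Context: $A$ is a Boolean algebra with least element $0$ and greatest element $1$; it is complete if it is a complete lattice. For $p\le q$ in $A$ the order interval is $[p,q]=\{r\in A : p\le r\le q\}$. An element $a\in A$ is an atom if $a>0$ and $[0,a]=\{0,a\}$; $A$ is atomic if for every $b>0$ the interval $[0,b]$ contains an atom. A filter on a set $\Omega$ is a (proper, nonempty) filter of subsets of $\Omega$; an ultrafilter is a maximal such filter. A filter $\mathcal{F}$ on $A$ order converges to $p\in A$ if $\mathcal{F}$ contains a collection of order intervals whose intersection is $\{p\}$. Equivalently, in terms of nets: $(p_\alpha)$ order converges to $p$ if there are an increasing net $(q_\beta)_{\beta\in B}$ and a decreasing net $(r_\beta)_{\beta\in B}$ with $\bigvee_\beta q_\beta=p=\bigwedge_\beta r_\beta$ such that for every $\beta$ there is $\alpha_0$ with $q_\beta\le p_\alpha\le r_\beta$ for all $\alpha\ge\alpha_0$; a filter order converges to $p$ iff it is generated by the tails of a net that order converges to $p$. A subset $S\subseteq A$ is order compact if every ultrafilter on $A$ that contains $S$ order converges to an element of $S$ (equivalently, every net in $S$ has a subnet that order converges to an element of $S$); in particular, $A$ is order compact if every ultrafilter on $A$ order converges to an element of $A$. $A$ is order locally compact if every order convergent filter on $A$ contains an order compact set. *)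

(* Defs.v *)
From mathcomp Require Export all_boot all_order.
From mathcomp Require Export interval boolp classical_sets set_interval filter.
From mathcomp Require Export topology.

Set Implicit Arguments.
Unset Strict Implicit.
Unset Printing Implicit Defensive.

Import Order.TTheory.

Local Open Scope order_scope.
Local Open Scope classical_set_scope.

Definition complete_lattice d (T : latticeType d) : Prop :=
  forall S : set T, supremums S !=set0 /\ infimums S !=set0.

(* [ctbDistrLatticeType] allows [\bot = \top]: the one-element Boolean algebra
   is included. *)
Definition atom d (A : ctbDistrLatticeType d) (a : A) : Prop :=
  \bot < a /\ `[\bot, a] = [set \bot; a] :> set A.

Definition atomic d (A : ctbDistrLatticeType d) : Prop :=
  forall b : A, \bot < b -> exists2 a : A, `[\bot, b] a & atom a.

Definition order_interval d (A : ctbDistrLatticeType d) (I : set A) : Prop :=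
  exists p q : A, p <= q /\ I = `[p, q].

(* Filters are filters of subsets of [A], not order filters in [A]. *)
Definition order_cvg d (A : ctbDistrLatticeType d) (F : set_system A) (p : A)
    : Prop :=
  exists C : set_system A,
    [/\ C `<=` F, C `<=` @order_interval d A & \bigcap_(I in C) I = [set p]].

Definition order_compact d (A : ctbDistrLatticeType d) (S : set A) : Prop :=
  forall F : set_system A, UltraFilter F -> F S ->
    exists2 p : A, S p & order_cvg F p.

Definition order_locally_compact d (A : ctbDistrLatticeType d) : Prop :=
  forall F : set_system A, ProperFilter F -> (exists p : A, order_cvg F p) ->
    exists2 S : set A, F S & order_compact S.

(* Main.v *)
Require Import Defs.

(* A proper filter F order converges to p iff p is both the supremum of the q
   with [q, 1] in F and the infimum of the r with [0, r] in F.

   If A is complete and atomic, an ultrafilter F contains [a, 1] or [0, ~a] for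
   each atom a, and converges to the join of the atoms of the first kind.

   If A is order compact, sup S is the limit of any ultrafilter containing the
   tails of the ideal of elements below all upper bounds of S. If nothing below
   b > 0 is an atom, finitely many nonzero elements below b can be split by a
   single x, so some ultrafilter contains, for every 0 < u <= b, the set of all
   x splitting u; a limit p would satisfy b <= p <= ~b.

   If A is order locally compact and F is an ultrafilter, the c such that the
   trace of F on [0, c] converges form an ideal, containing every atom and
   every x with [0, x] inside an order compact set. If it does not contain 1,
   extend it to a prime ideal M. The complement D of M has infimum 0, as a
   nonzero lower bound of D would be an atom in D. Hence the filter generated
   by the [0, x] with x in D converges to 0, so some [0, x] with x in D lies in
   an order compact set, contradicting that D avoids the ideal. *)

Set Implicit Arguments.
Unset Strict Implicit.
Unset Printing Implicit Defensive.

Import Order.TTheory Order.CTheory.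

Local Open Scope classical_set_scope.
Local Open Scope order_scope.

(** * Ultrafilters and their images *)

Lemma ultra_of_setVsetC T (F : set_system T) : ProperFilter F ->
  (forall X, F X \/ F (~` X)%classic) -> UltraFilter F.
Proof.
move=> FF FXC; split=> // G GG FG; apply/seteqP; split=> // X GX.
by case: (FXC X) => // /FG GXC; have [x []] := filter_ex (filterI GX GXC).
Qed.

Lemma fmap_ultra T U (f : T -> U) (F : set_system T) :
  UltraFilter F -> UltraFilter (fmap f F).
Proof.
move=> FU; apply: ultra_of_setVsetC => X.
by rewrite /fmap /= preimage_setC; exact: in_ultra_setVsetC.
Qed.

Section BooleanAlgebra.
Context {d : Order.disp_t} {A : ctbDistrLatticeType d}.
Implicit Types (F G : set_system A) (S I M : set A).
Implicit Types (a b c p q r s t u v w x y z : A).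

(** * Intervals and order convergence *)

Lemma itvccE p q x : (`[p, q]%classic x : Prop) = (p <= x <= q) :> Prop.
Proof. by rewrite /mkset /= in_itv. Qed.

Lemma itvc1E p x : (`[p, \top]%classic x : Prop) = (p <= x) :> Prop.
Proof. by rewrite itvccE lex1 andbT. Qed.

Lemma itv0cE p x : (`[\bot, p]%classic x : Prop) = (x <= p) :> Prop.
Proof. by rewrite itvccE le0x. Qed.

Lemma leI_compl x y z : (x `&` y <= z) = (x <= ~` y `|` z).
Proof. by rewrite -leBLR diffE complK. Qed.

Lemma le_compl_self_eq0 x : x <= ~` x -> x = \bot.
Proof. by rewrite -disj_leC meetxx => /eqP. Qed.

Definition below F : set A := [set q | F `[q, \top]%classic].

Definition above F : set A := [set r | F `[\bot, r]%classic].

Lemma order_interval_below_above F p q : ProperFilter F ->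
  F `[p, q]%classic -> below F p /\ above F q.
Proof.
move=> FF Fpq; split; apply: filterS Fpq => x;
  by rewrite itvccE ?itvc1E ?itv0cE => /andP[].
Qed.

Lemma below_le_above F q r : ProperFilter F -> below F q -> above F r -> q <= r.
Proof.
move=> FF Fq Fr; have [x []] := filter_ex (filterI Fq Fr).
by rewrite itvc1E itv0cE; exact: le_trans.
Qed.

(** Forward: an [x] in every interval of [F] around [p] lies in all members of [C], so equals [p];
    this is applied to joins and meets of [p] with the bounds to be compared. Backward: all
    intervals in [F] serve as [C]. *)
Lemma order_cvgP F p : ProperFilter F ->
  order_cvg F p <-> supremums (below F) p /\ infimums (above F) p.
Proof.
move=> FF; split=> [[C [CF CI Cp]]|[[ubp lep] [lbp gep]]].
  have Cmem x : (forall q r, q <= p <= r -> below F q -> above F r ->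
      q <= x <= r) -> x = p.
    move=> H; have : (\bigcap_(I in C) I)%classic x.
      move=> I CI'; have [q [r [qr Iqr]]] := CI _ CI'.
      have := CF _ CI'; rewrite Iqr => FI.
      have [Fq Fr] := order_interval_below_above FF FI.
      rewrite itvccE; apply: H => //.
      have : (\bigcap_(I in C) I)%classic p by rewrite Cp.
      by move=> /(_ _ CI'); rewrite Iqr itvccE.
    by rewrite Cp.
  split; split.
  - move=> q' Fq'; rewrite -(Cmem (p `|` q')) ?leUr// => q r /andP[qp pr] Fq Fr.
    by rewrite leUx pr lexU2 ?qp//=; exact: below_le_above Fq' Fr.
  - move=> z zub; rewrite -(Cmem (p `&` z)) ?leIr// => q r /andP[qp pr] Fq Fr.
    by rewrite lexI qp leIx2 ?pr// zub.
  - move=> r' Fr'; rewrite -(Cmem (p `&` r')) ?leIr// => q r /andP[qp pr] Fq Fr.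
    by rewrite lexI qp leIx2 ?pr// andbT; exact: below_le_above Fq Fr'.
  - move=> z zlb; rewrite -(Cmem (p `|` z)) ?leUr// => q r /andP[qp pr] Fq Fr.
    by rewrite leUx pr lexU2 ?qp// zlb.
exists [set I | F I /\ order_interval I]%classic; split; [by move=> I []..|].
apply/seteqP; split=> [x Ix|_ -> I [FI [q [r [qr Iqr]]]]]; last first.
  have [Fq Fr] : below F q /\ above F r.
    by apply: order_interval_below_above; rewrite -Iqr.
  by rewrite Iqr itvccE ubp ?lbp.
apply/eqP; rewrite eq_le; apply/andP; split.
  apply: gep => r Fr; rewrite -(itv0cE r); apply: Ix; split=> //.
  by exists \bot, r; split=> //; exact: le0x.
apply: lep => q Fq; rewrite -(itvc1E q); apply: Ix; split=> //.
by exists q, \top; split=> //; exact: lex1.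
Qed.

(** * Elements below which a filter converges *)

Lemma above_top F : Filter F -> above F \top.
Proof. by move=> FF; apply: filterS filterT => x _; rewrite itv0cE lex1. Qed.

(* The elements below which [F] converges, i.e. those [c] for which the trace
   of [F] on [[\bot, c]] has an order limit. *)
Definition cvg_domain F : set A := [set c | exists p,
  supremums [set (q `&` c)%O | q in below F]%classic p /\
  infimums [set (r `&` c)%O | r in above F]%classic p].

Definition ideal I : Prop :=
  [/\ I \bot, forall x y, x <= y -> I y -> I x &
      forall x y, I x -> I y -> I (x `|` y)].

(** By distributivity, a limit below [c] meets [e <= c] in a limit below [e], and limits below [c1]
    and [c2] combine to their join. *)
Lemma cvg_domain_ideal F : ProperFilter F -> ideal (cvg_domain F).
Proof.
move=> FF; split.
- exists \bot; split; split.
  + by move=> _ [q _ <-]; rewrite meetx0.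
  + by move=> z _; exact: le0x.
  + by move=> _ [q _ <-]; exact: le0x.
  + by move=> z; apply; exists \top; [exact: above_top|exact: meetx0].
- move=> e c ec [p [[ub lub] [lb glb]]].
  exists (p `&` e); split; split.
  + move=> _ [q Fq <-]; rewrite lexI leIr andbT.
    by apply: le_trans (leI2 (lexx q) ec) _; apply: ub; exists q.
  + move=> z zub; rewrite leI_compl; apply: lub => _ [q Fq <-].
    rewrite (le_trans (leIl _ _))// -leI_compl.
    by apply: zub; exists q.
  + move=> _ [r Fr <-]; rewrite leI2//.
    by apply: le_trans (leIl r c); apply: lb; exists r.
  + move=> z zlb; rewrite lexI; apply/andP; split.
      apply: glb => _ [r Fr <-]; apply: le_trans (leI2 (lexx r) ec).
      by apply: zlb; exists r.
    rewrite -[leRHS]meet1x; apply: zlb; exists \top => //; exact: above_top.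
- move=> c1 c2 [p1 [[ub1 lub1] [lb1 glb1]]] [p2 [[ub2 lub2] [lb2 glb2]]].
  exists (p1 `|` p2); split; split.
  + move=> _ [q Fq <-]; rewrite meetUr leU2//; [apply: ub1|apply: ub2];
      by exists q.
  + move=> z zub; rewrite leUx; apply/andP; split; [apply: lub1|apply: lub2];
      move=> _ [q Fq <-];
      apply: le_trans (zub (q `&` (c1 `|` c2)) _);
      by rewrite ?leI2 ?leUl ?leUr//; exists q.
  + move=> _ [r Fr <-]; rewrite meetUr leU2//; [apply: lb1|apply: lb2];
      by exists r.
  + move=> z zlb.
    have zr r : above F r -> z <= r `&` (c1 `|` c2).
      by move=> ?; apply: zlb; exists r.
    (* The bound [r = \top] puts [z] below the join of [c1] and [c2], so [z] splits into a part
       below each. *)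
    have /meet_l <- : z <= c1 `|` c2.
      by rewrite -[leRHS]meet1x; apply: zr; exact: above_top.
    rewrite meetUr leU2//; [apply: glb1|apply: glb2] => _ [r Fr <-];
      by rewrite leI2// (le_trans (zr _ Fr))// leIl.
Qed.

Lemma cvg_domain_top F : ProperFilter F -> cvg_domain F \top ->
  exists p, order_cvg F p.
Proof.
move=> FF [p]; rewrite (_ : Order.meet^~ \top = id) ?image_id; last first.
  by apply/funext => x; exact: meetx1.
by move=> H; exists p; apply/order_cvgP.
Qed.

(** Such a [z] is [\bot] or an atom. The trace of [F] converges to [z] if [F] contains the up-set of
    [z], and to [\bot] otherwise. *)
Lemma cvg_domain_minimal F z : UltraFilter F ->
  (forall y, y < z -> y = \bot) -> cvg_domain F z.
Proof.
move=> FU zmin; have [Fz|Fz] := in_ultra_setVsetC `[z, \top]%classic FU.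
  exists z; split; split.
  - by move=> _ [q _ <-]; exact: leIr.
  - by move=> y; apply; exists z => //; exact: meetxx.
  - by move=> _ [r Fr <-]; rewrite lexI lexx (below_le_above _ Fz Fr).
  - move=> y; rewrite -[z in y <= z]meet1x.
    by apply; exists \top => //; exact: above_top.
have Fcz : above F (~` z).
  apply: filterS Fz => x xz; rewrite itv0cE -disj_leC; apply/eqP/zmin.
  rewrite lt_leAnge leIr lexI lexx andbT; apply/negP.
  by rewrite -itvc1E.
exists \bot; split; split.
- move=> _ [q Fq <-]; rewrite (_ : q `&` z = \bot)//; apply/eqP.
  by rewrite disj_leC (below_le_above _ Fq Fcz).
- by move=> y _; exact: le0x.
- by move=> _ [r Fr <-]; exact: le0x.
- by move=> y; apply; exists (~` z) => //; exact: meetCx.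
Qed.

(** The image of [F] under meet with [x] is an ultrafilter containing [S]; its limit is that of the
    trace of [F]. *)
Lemma order_compact_cvg_domain F S x : UltraFilter F -> order_compact S ->
  (`[\bot, x] `<=` S)%classic -> cvg_domain F x.
Proof.
move=> FU Sc xS; pose G := fmap (Order.meet^~ x) F.
have GU : UltraFilter G by exact: fmap_ultra.
have GE q r : G `[q, r]%classic = F [set y | (q <= y `&` x <= r)%O]%classic.
  by congr F; apply/funext => y; exact: itvccE.
have Gx : above G x.
  by rewrite /above /= GE; apply: filterS filterT => y _ /=; rewrite le0x leIr.
have [p _ /order_cvgP[[ub lub] [lb glb]]] := Sc G GU (filterS xS Gx).
exists p; split; split.
- move=> _ [q Fq <-]; apply: ub; rewrite /below /= GE; apply: filterS Fq => y.
  by rewrite itvc1E /= lex1 andbT => qy; rewrite leI2.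
- move=> z zub; apply: lub => q Gq.
  have qx : q <= x by exact: below_le_above Gq Gx.
  rewrite -(meet_l qx); apply: zub; exists q => //.
  move: Gq; rewrite /below /= GE; apply: filterS => y.
  by rewrite itvc1E => /andP[qyx _]; apply: le_trans qyx _; exact: leIl.
- move=> _ [r Fr <-]; apply: lb; rewrite /above /= GE; apply: filterS Fr => y.
  by rewrite itv0cE /= le0x => yr; rewrite leI2.
- move=> z zlb; apply: glb => r Gr.
  (* The largest element whose meet with [x] is below [r] turns an upper bound for [G] into one for
     [F]. *)
  apply: (@le_trans _ _ ((~` x `|` r) `&` x)).
    apply: zlb; exists (~` x `|` r) => //.
    move: Gr; rewrite /above /= GE; apply: filterS => y.
    by rewrite itv0cE -leI_compl => /andP[].
  by rewrite leI_compl.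
Qed.

(** * Prime ideals; from local compactness to compactness *)

(** By Zorn's lemma. The empty chain has empty union, so [P] must hold of the empty set: it asks for
    stability under joins with [I] instead of inclusion of [I]. *)
Lemma prime_ideal_extension I : ideal I -> ~ I \top ->
  exists M,
    [/\ ideal M, (I `<=` M)%classic, ~ M \top & forall x, M x \/ M (~` x)].
Proof.
move=> [I0 Ile IU] I1.
pose P M := [/\ forall x y, x <= y -> M y -> M x,
  forall x y, M x -> M y -> M (x `|` y), ~ M \top &
  forall x y, M x -> I y -> M (x `|` y)].
have [C CP Ctot|M [[Mle MU M1 MI] Mmax]] := @Zorn_bigcup A P.
  split=> [x y xy [X CX Xy]|x y [X CX Xx] [Y CY Yy]|[X CX]|x y [X CX Xx] Iy].
  - by exists X => //; have [Xle _ _ _] := CP _ CX; exact: Xle Xy.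
  - have [XY|YX] := Ctot _ _ CX CY.
      by exists Y => //; have [_ YU _ _] := CP _ CY; apply: YU => //; exact: XY.
    by exists X => //; have [_ XU _ _] := CP _ CX; apply: XU => //; exact: YX.
  - by have [] := CP _ CX.
  - by exists X => //; have [_ _ _ XI] := CP _ CX; exact: XI.
have [m0 Mm0] : (M !=set0)%classic.
  apply/set0P/negP => /eqP M0; apply: (Mmax I); last by split.
  by rewrite M0; split=> // sub; exact: sub I0.
have M0 : M \bot by exact: Mle (le0x m0) Mm0.
exists M; split=> // [y Iy|x]; first by rewrite -[y]join0x; exact: MI.
have [Mx|nMx] := pselect (M x); [by left|right].
apply: contrapT => nMCx.
(* The ideal generated by [M] and [x] is strictly larger; if it contained [\top], the complement of
   [x] would be in [M]. *)
apply: (Mmax [set y | exists2 m, M m & (y <= m `|` x)%O]%classic).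
  split=> [y My|sub]; first by exists y => //; exact: leUl.
  by apply/nMx/sub; exists \bot => //; exact: leUr.
split=> [y z yz [m Mm zm]|y z [m Mm ym] [n Mn zn]|[m Mm]|y z [m Mm ym] Iz].
- by exists m => //; exact: le_trans zm.
- exists (m `|` n); first exact: MU.
  rewrite leUx (le_trans ym) ?leU2 ?leUl//= (le_trans zn)//.
  by rewrite leU2 ?leUr.
- move=> m1; apply: nMCx; apply: Mle Mm.
  by rewrite -[m]complK -disj_leC -complU joinC; apply/eqP; rewrite -compl1;
    congr (~` _); apply/eqP; rewrite eq_le lex1.
- exists (m `|` z); first exact: MI.
  by rewrite joinAC leU2.
Qed.

Lemma order_locally_compact_compact :
  order_locally_compact A -> order_compact [set: A].
Proof.
move=> lc F FU _.
suff [p Fp] : exists p, order_cvg F p by exists p.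
apply: cvg_domain_top; apply: contrapT => J1.
have [M [[M0 Mle MU] JM M1 Mprime]] :=
  prime_ideal_extension (cvg_domain_ideal _) J1.
have MC x : M x -> M (~` x) -> False.
  by move=> Mx MCx; apply: M1; rewrite -(joinxC x); exact: MU.
pose D := (~` M)%classic.
pose G := filter_from D (fun x => `[\bot, x]%classic).
have GG : ProperFilter G.
  apply: filter_from_proper; last by move=> x _; exists \bot; rewrite itv0cE.
  apply: filter_from_filter; first by exists \top.
  move=> x y Dx Dy; exists (x `&` y).
    by move=> Mxy; apply: (MC _ Mxy); rewrite complI; apply: MU;
      [case: (Mprime x)|case: (Mprime y)].
  move=> z; rewrite itv0cE lexI => /andP[zx zy].
  by split; rewrite itv0cE.
have [|S [x Dx xS] Sc] := lc G GG; last first.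
  exact/Dx/JM/(order_compact_cvg_domain FU Sc xS).
exists \bot, [set `[\bot, x]%classic | x in D]%classic; split.
- by move=> _ [x Dx <-]; exists x.
- by move=> _ [x Dx <-]; exists \bot, x; split=> //; exact: le0x.
apply/seteqP; split=> [z Iz|_ -> _ [x _ <-]]; last by rewrite itv0cE le0x.
have Dle x : D x -> z <= x.
  by move=> Dx; rewrite -(itv0cE x); apply: Iz; exists x.
(* If the complement of [z] is not in [D], then [z] is. Any [y < z] is then outside [D], so its
   complement is in [D] and hence above [z], which forces [y = \bot]. *)
have [/Dle/le_compl_self_eq0//|/contrapT MCz] := pselect (D (~` z)).
have Dz : D z by move=> Mz; exact: MC Mz MCz.
exfalso; apply/Dz/JM/cvg_domain_minimal => y yz; apply: le_compl_self_eq0.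
apply: le_trans (ltW yz) (Dle _ _) => MCy.
have /Dle : D y by move=> My; exact: MC My MCy.
by rewrite (lt_geF yz).
Qed.

(** * From compactness to completeness *)

Lemma order_compact_supremums S :
  order_compact [set: A] -> (supremums S !=set0)%classic.
Proof.
move=> co; pose I := lbound (ubound S).
have I0 : I \bot by move=> t _; exact: le0x.
have [|W [WU GW]] :=
  @ultraFilterLemma _ (filter_from I (fun x => `[x, \top] `&` I)%classic).
  apply: filter_from_proper; last first.
    by move=> x Ix; exists x; split=> //; rewrite itvc1E.
  apply: filter_from_filter; first by exists \bot.
  move=> x y Ix Iy; exists (x `|` y).
    by move=> t tub; rewrite leUx Ix ?Iy.
  move=> z [+ Iz]; rewrite itvc1E leUx => /andP[xz yz].
  by split; split=> //; rewrite itvc1E.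
have [p _ /order_cvgP[[ub lub] _]] := co W WU filterT.
exists p; split=> [x Sx|t tub].
  by apply/ub/GW; exists x => [t|y []//]; exact.
apply: lub => q Wq; apply: below_le_above Wq _.
by apply: GW; exists \bot => // y [_ Iy]; rewrite itv0cE; exact: Iy.
Qed.

Lemma order_compact_complete :
  order_compact [set: A] -> complete_lattice A.
Proof.
move=> co S; split; first exact: order_compact_supremums.
(* The infimum of [S] is the supremum of its lower bounds. *)
have [p [ub lub]] := order_compact_supremums (lbound S) co.
by exists p; split=> // x Sx; apply: lub => y; exact.
Qed.

(** * From compactness to atomicity *)

Section Atomless.
Context {b : A}.
Hypothesis b_atomless :
  forall u, \bot < u -> u <= b -> exists2 w, \bot < w & w < u.

(** Whenever the current [w] lies above some [v], pass to a nonzero element strictly below that [v];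
    shrinking keeps the earlier conditions. *)
Lemma small_piece u (vs : seq A) : \bot < u -> u <= b ->
    all (> \bot) vs ->
  exists w, [/\ \bot < w, w <= u & all (fun v => ~~ (v <= w)) vs].
Proof.
move=> u0 ub; elim: vs => [_|v vs IH /= /andP[v0 /IH[w [w0 wu vsw]]]].
  by exists u.
have [vw|vw] := boolP (v <= w); last by exists w; rewrite vw.
have [w' w'0 w'v] := b_atomless v0 (le_trans vw (le_trans wu ub)).
exists w'; rewrite w'0 (le_trans (ltW w'v) (le_trans vw wu)) (lt_geF w'v).
split=> //=; apply: sub_all vsw => t; apply: contra => tw'.
exact: le_trans tw' (le_trans (ltW w'v) vw).
Qed.

(** Induction on [us] with [vs] fixed. An [x] disjoint from [u] is enlarged by a piece [w] of [u]
    that lies above no difference of a [v] and [x], so no [v] falls below the join. *)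
Lemma splitting_element (us vs : seq A) :
    all (fun u => \bot < u <= b) us -> all (> \bot) vs ->
  exists x, all (fun u => u `&` x != \bot) us /\ all (fun v => ~~ (v <= x)) vs.
Proof.
move=> usb vs0.
elim: us usb => [_|u us IH /= /andP[/andP[u0 ub] /IH[x [usx vsx]]]].
  by exists \bot; split=> //; apply: sub_all vs0 => v; rewrite lex0 lt0x.
have [ux|ux] := eqVneq (u `&` x) \bot; last by exists x; rewrite ux.
have vsx0 : all (> \bot) [seq v `\` x | v <- vs].
  by rewrite all_map; apply: sub_all vsx => v vx /=; rewrite lt0x diff_eq0.
have [w [w0 wu]] := small_piece u0 ub vsx0; rewrite all_map => vsw.
exists (x `|` w); split.
  rewrite meetUr ux join0x (meet_r wu) -lt0x w0 /=.
  apply: sub_all usx => t; apply: contra => /eqP tx.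
  by rewrite -lex0 -tx leI2 ?leUl.
by apply: sub_all vsw => v; rewrite /= leBLR.
Qed.

End Atomless.

Lemma order_compact_atomic : order_compact [set: A] -> atomic A.
Proof.
move=> co b b0; apply: contrapT => no_atom.
have b_atomless u : \bot < u -> u <= b -> exists2 w, \bot < w & w < u.
  move=> u0 ub; apply: contrapT => umin; apply: no_atom; exists u.
    by rewrite itv0cE.
  split=> //; apply/seteqP; split=> [x|x [->|->]]; rewrite itv0cE ?le0x//.
  rewrite le_eqVlt => /predU1P[->|xu]; [by right|left].
  apply: contrapT => /eqP x0; apply: umin; exists x => //.
  by rewrite lt0x.
pose splits x u := (u `&` x != \bot) && ~~ (u <= x).
have [|W [WU GW]] := @ultraFilterLemma _ (filter_from
    [set us | all (fun u => (\bot < u <= b)%O) us]%classic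
    (fun us => [set x | all (splits x) us]%classic)).
  apply: filter_from_proper; last first.
    move=> us usb.
    have us0 : all (> \bot) us by apply: sub_all usb => u /andP[].
    have [x [xus xvs]] := splitting_element b_atomless usb us0.
    by exists x; rewrite /= all_predI xus.
  apply: filter_from_filter; first by exists [::].
  move=> us vs usb vsb; exists (us ++ vs); first by rewrite /= all_cat usb.
  by move=> x; rewrite /= all_cat => /andP[].
have Wb u : \bot < u -> u <= b ->
    W [set x | splits x u]%classic.
  move=> u0 ub; apply: GW; exists [:: u] => /=; first by rewrite u0 ub.
  by move=> x /=; rewrite andbT.
have [p _ /order_cvgP[[ub lub] [lb glb]]] := co W WU filterT.
(* If the part of [b] outside [r] were nonzero, some [x <= r] would meet it. *)
have bp : b <= p.
  apply: glb => r Wr; rewrite -diff_eq0; apply: contrapT => /negP br.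
  have [|x [+ /= /andP[+ _]]] := filter_ex (filterI Wr (Wb _ _ (leBx b r))).
    by rewrite lt0x.
  rewrite itv0cE => xr /eqP; apply; apply/eqP.
  by rewrite -lex0 (le_trans (leI2 (lexx _) xr))// diffIK.
(* If [q] met [b], some [x >= q] would fail to contain their meet. *)
have pb : p <= ~` b.
  apply: lub => q Wq; rewrite -disj_leC; apply: contrapT => /negP qb.
  have [|x [+ /= /andP[_ +]]] := filter_ex (filterI Wq (Wb _ _ (leIr b q))).
    by rewrite lt0x.
  by rewrite itvc1E => qx /negP; apply; apply: le_trans (leIl _ _) qx.
by move: b0; rewrite (le_compl_self_eq0 (le_trans bp pb)) ltxx.
Qed.

(** * From completeness and atomicity to compactness *)

Lemma atom_le_or_le_compl a x : atom a -> a <= x \/ a <= ~` x.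
Proof.
move=> [a0 aE]; have : `[\bot, a]%classic (a `&` x) by rewrite itv0cE leIl.
rewrite aE => -[/eqP|/meet_idPl]; last by left.
by rewrite disj_leC; right.
Qed.

(** Otherwise an atom under the difference of [x] and [y] would lie below both [y] and its
    complement. *)
Lemma atomic_le x y : atomic A ->
  (forall a, atom a -> a <= x -> a <= y) -> x <= y.
Proof.
move=> atA xy; rewrite -diff_eq0; apply/negPn/negP => nxy.
have [|a] := atA (x `\` y); first by rewrite lt0x.
rewrite itv0cE => axy ata; have ay := xy a ata (le_trans axy (leBx _ _)).
have : a <= ~` a by apply: le_trans axy (le_trans (leBC _ _) _); rewrite leC.
by move=> /le_compl_self_eq0 a0; case: ata; rewrite a0 ltxx.
Qed.

Lemma complete_atomic_order_compact :
  complete_lattice A -> atomic A -> order_compact [set: A].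
Proof.
move=> cA atA F FU _.
have Fatom a : atom a -> below F a \/ above F (~` a).
  move=> ata; have [Fa|Fa] := in_ultra_setVsetC `[a, \top]%classic FU.
    by left.
  right; apply: filterS Fa => x nax; rewrite itv0cE lexC.
  have [ax|//] := atom_le_or_le_compl x ata.
  by exfalso; apply: nax; rewrite itvc1E.
have [[p [ub lub]] _] := cA [set a | atom a /\ below F a]%classic.
exists p => //; apply/order_cvgP; split; split.
- move=> q Fq; apply: atomic_le => // a ata aq; apply: ub; split=> //.
  by apply: filterS Fq => x; rewrite !itvc1E; exact: le_trans.
- by move=> z zub; apply: lub => a [_ Fa]; exact: zub.
- by move=> r Fr; apply: lub => a [_ Fa]; exact: below_le_above Fa Fr.
- move=> z zlb; apply: atomic_le => // a ata az.
  have [Fa|Fa] := Fatom a ata; first exact: ub.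
  have : a <= ~` a by exact: le_trans az (zlb _ Fa).
  by move=> /le_compl_self_eq0 a0; case: ata; rewrite a0 ltxx.
Qed.

End BooleanAlgebra.

Theorem corollary3p3 (d : Order.disp_t) (A : ctbDistrLatticeType d) :
  [<-> complete_lattice A /\ atomic A;
       order_compact [set: A];
       order_locally_compact A].
Proof.
tfae.
- by move=> [cA atA]; exact: complete_atomic_order_compact.
- by move=> co F FF _; exists [set: A] => //; exact: filterT.
- move=> /order_locally_compact_compact co.
  by split; [exact: order_compact_complete|exact: order_compact_atomic].
Qed.
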